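(* Let $d \ge 1$. For all $A \subseteq \mathbb{R}^d$, $D_H(A) = D(A)$; that is, the covering dimension and the counting dimension of $A$ coincide.
   Context: A cube in $\mathbb{R}^d$ is a set $C = \prod_{i=1}^d [a_i, a_i+\ell)$ with $a \in \mathbb{R}^d$, $\ell > 0$; its side length is $\|C\| = \ell$. For $A \subseteq \mathbb{R}^d$, $\lfloor A \rfloor = \{(\lfloor a_1\rfloor,\dots,\lfloor a_d \rfloor) \mid a \in A\} \subseteq \mathbb{Z}^d$. For $\alpha \ge 0$, the $\alpha$-counting measure of $A$ is $$d^{\alpha}(A) = \limsup_{\|C\|\to\infty} \frac{|\lfloor A \rfloor \cap C|}{\|C\|^\alpha} := \lim_{\ell\to\infty} \sup_{\|C\| \ge \ell} \frac{|\lfloor A \rfloor \cap C|}{\|C\|^\alpha},$$ the supremum being over cubes $C \subseteq \mathbb{R}^d$. The counting dimension of $A$ is $D(A) = \inf\{\alpha \ge 0 \mid d^\alpha(A) = 0\}$. For $\alpha \ge 0$, the $\alpha$-covering measure of $A$ is $$d_H^\alpha(A) = \lim_{r \to 0} \limsup_{\|C\|\to\infty} \inf\left\{ \sum_i \left(\frac{\|C_i\|}{\|C\|}\right)^\alpha \ \middle|\ A \cap C \subseteq \bigcup_i C_i,\ 1 \le \|C_i\| \le r\|C\| \right\},$$ where the limit supremum is over cubes $C \subseteq \mathbb{R}^d$ with $\|C\| \to \infty$ (that is, $\limsup_{\|C\|\to\infty}$ means $\lim_{\ell\to\infty} \sup_{\|C\| \ge \ell}$, the supremum being over cubes $C \subseteq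 \mathbb{R}^d$ with side length at least $\ell$), the infimum is over all collections of cubes $\{C_i\}$ in $\mathbb{R}^d$ satisfying the given conditions, and the infimum of the empty set is taken to be $0$. The covering dimension of $A$ is $D_H(A) = \inf\{\alpha \ge 0 \mid d_H^\alpha(A) = 0\}$. *)

(* Defs.v *)
From mathcomp Require Export all_boot all_order all_algebra.
From mathcomp Require Export all_classical all_reals all_analysis.

Set Implicit Arguments.
Unset Strict Implicit.
Unset Printing Implicit Defensive.

Import Order.TTheory GRing.Theory Num.Theory.
Import numFieldNormedType.Exports.

Local Open Scope classical_set_scope.
Local Open Scope ring_scope.

(* A cube is encoded by its lower corner and its positive side length; for
   d >= 1 distinct pairs give distinct cubes. *)
Definition cube (R : realType) (d : nat) : Type := ('rV[R]_d * {posnum R})%type.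

Definition side (R : realType) (d : nat) (C : cube R d) : R := C.2%:num.

Definition cube_set (R : realType) (d : nat) (C : cube R d) : set 'rV[R]_d :=
  [set x | forall i, C.1 0 i <= x 0 i < C.1 0 i + side C].

Definition floor_set (R : realType) (d : nat) (A : set 'rV[R]_d) :
    set 'rV[int]_d :=
  [set map_mx (@Num.floor R) a | a in A].

Definition int_points (R : realType) (d : nat) (C : cube R d) : set 'rV[int]_d :=
  [set z | cube_set C (map_mx intr z)].

Definition limsup_cubes (R : realType) (d : nat) (f : cube R d -> \bar R) :
    \bar R :=
  lim ((fun l : R => ereal_sup [set f C | C in [set C | l <= side C]])
         @ +oo).

Definition counting_measure (R : realType) (d : nat) (alpha : R)
    (A : set 'rV[R]_d) : \bar R :=
  limsup_cubes (fun C : cube R d =>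
    (counting (floor_set A `&` int_points C) * ((side C `^ alpha)^-1)%:E)%E).

(* The dimensions take values in the extended reals, so that the infimum needs
   no nonemptiness side condition. *)
Definition counting_dim (R : realType) (d : nat) (A : set 'rV[R]_d) : \bar R :=
  ereal_inf [set alpha%:E |
    alpha in [set alpha : R | 0 <= alpha /\ counting_measure alpha A = 0%E]].

(* ereal_inf, except that the infimum of the empty set is 0 instead of +oo. *)
Definition inf0 (R : realType) (S : set (\bar R)) : \bar R :=
  if `[< S = set0 >] then 0%E else ereal_inf S.

(* The collections are arbitrary (finite or infinite) sets of cubes. *)
Definition admissible_cover (R : realType) (d : nat) (A : set 'rV[R]_d) (r : R)
    (C : cube R d) (S : set (cube R d)) : Prop :=
  A `&` cube_set C `<=` \bigcup_(Ci in S) cube_set Ci /\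
  forall Ci, S Ci -> 1 <= side Ci <= r * side C.

Definition covering_content (R : realType) (d : nat) (alpha : R)
    (A : set 'rV[R]_d) (r : R) (C : cube R d) : \bar R :=
  inf0 [set (\esum_(Ci in S) ((side Ci / side C) `^ alpha)%:E)%E |
    S in admissible_cover A r C].

Definition covering_measure (R : realType) (d : nat) (alpha : R)
    (A : set 'rV[R]_d) : \bar R :=
  lim ((fun r : R => limsup_cubes (covering_content alpha A r)) @ 0^'+).

Definition covering_dim (R : realType) (d : nat) (A : set 'rV[R]_d) : \bar R :=
  ereal_inf [set alpha%:E |
    alpha in [set alpha : R | 0 <= alpha /\ covering_measure alpha A = 0%E]].

(* Main.v *)
Require Import Defs.
From mathcomp Require Import finmap lra.

Set Implicit Arguments.
Unset Strict Implicit.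
Unset Printing Implicit Defensive.

Import Order.TTheory GRing.Theory Num.Theory.
Import numFieldNormedType.Exports.

Local Open Scope classical_set_scope.
Local Open Scope ring_scope.

(** For each exponent alpha, the two measures are compared through the growth
    of the number of floor points of A in a cube C of side at least 1.

    If the alpha-counting measure of A vanishes, cover [A `&` cube_set C] by the
    unit cubes whose lower corners are the floor points of A in C enlarged by
    one unit. The content of this cover is (number of these points) /
    (side C)^alpha, which tends to 0; so the alpha-covering measure vanishes
    ([counting_measure0_covering]), and covering_dim A <= counting_dim A.

    Conversely, if the alpha-covering measure vanishes, then every cube C larger
    than some scale L has a cover by cubes of at most half its side whose
    content is at most 1 ([covering_measure0_covers]). The count
    N(C) = #|floor_set (A `&` cube_set C)| is bounded by a constant K on the
    cubes of side at most L, and a cover with content at most 1 propagates the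
    bound N(Ci) <= K (side Ci)^alpha from its members to C:
      N(C) <= \sum_i N(Ci) <= K (side C)^alpha \sum_i (side Ci / side C)^alpha
           <= K (side C)^alpha.
    Halving the side reaches L after finitely many steps, so
    N(C) <= K (side C)^alpha for all C of side at least 1 ([covers_growth]).
    Hence the beta-counting measure vanishes for every beta > alpha
    ([growth_counting_measure0]), which suffices for the infimum:
    counting_dim A <= covering_dim A. *)

(** * Counting as a sum of ones *)

Lemma counting_ge0 (R : realType) (T : choiceType) (X : set T) :
  (0 <= counting X :> \bar R)%E.
Proof. by rewrite /counting; case: ifP => _; rewrite ?lee_fin ?leey. Qed.

Lemma le_counting (R : realType) (T U : choiceType) (X : set T) (Y : set U) :
  (X #<= Y)%card -> (counting X <= counting Y :> \bar R)%E.
Proof.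
move=> XY; rewrite /counting.
case: (asboolP (finite_set Y)) => [finY|_]; last exact: leey.
rewrite asboolT; last exact: card_le_finite finY.
rewrite lee_fin ler_nat; have /finite_setP[n Yn] := finY.
rewrite (card_fset_set Yn); apply: geq_card_fset_set.
by rewrite -(card_le_eqr Yn).
Qed.

(** Turns cardinalities into unordered sums, so that sub-additivity over
    arbitrary families needs no case split on finiteness. *)
Lemma esum1_counting (R : realType) (T : choiceType) (X : set T) :
  (\esum_(x in X) (1 : R)%:E = counting X)%E.
Proof.
have finE (Y : set T) : finite_set Y ->
    (\sum_(x \in Y) (1 : R)%:E = (#|` fset_set Y|)%:R%:E :> \bar R)%E.
  by move=> finY; rewrite fsbig_finite// card_fset_sum1 natr_sum -sumEFin.
rewrite /counting; case: (asboolP (finite_set X)) => [finX|infX].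
  by rewrite esum_fset// finE.
apply/eqyP => M M0.
have [B BX nB] := infinite_set_fset (Num.bound M) infX.
apply: (@le_trans _ _ (\sum_(x \in [set` B]) (1 : R)%:E)%E); last first.
  by apply: ereal_sup_ubound; exists [set` B].
rewrite finE; last exact: finite_fset.
rewrite set_fsetK lee_fin (le_trans (ltW (archi_boundP (ltW M0))))//.
by rewrite ler_nat.
Qed.

Lemma esumZl_le (R : realType) (T : choiceType) (S : set T) (c : \bar R)
    (a : T -> \bar R) : (0 <= c)%E -> (forall x, 0 <= a x)%E ->
  (\esum_(x in S) (c * a x) <= c * \esum_(x in S) a x)%E.
Proof.
move=> c0 a0; apply: ge_ereal_sup => _ [X XS <-].
rewrite -ge0_mule_fsumr//; apply: lee_wpmul2l => //.
by apply: ereal_sup_ubound; exists X.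
Qed.

(** The union is the image of the disjoint union [S `*`` F] under the second
    projection, and images do not increase cardinality. *)
Lemma counting_bigcup_le (R : realType) (I T : choiceType) (S : set I)
    (F : I -> set T) :
  (counting (\bigcup_(i in S) F i) <= \esum_(i in S) counting (F i) :> \bar R)%E.
Proof.
under eq_esum do rewrite -esum1_counting.
rewrite esum_esum; last by move=> *; rewrite lee_fin.
rewrite esum1_counting.
have -> : \bigcup_(i in S) F i = snd @` (S `*`` F).
  apply/seteqP; split=> [x [i Si Fx]|x [[i y] /= [Si Fy] <-]].
    by exists (i, x).
  by exists i.
exact: le_counting (card_image_le _ _).
Qed.

(** * Upper limits over large cubes *)

Section limsup_cubes.
Context {R : realType} {d : nat}.
Implicit Types (C : cube R d) (f g : cube R d -> \bar R).

Lemma side_gt0 C : 0 < side C. Proof. by rewrite /side. Qed.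

Let tail_sup f (l : R) := ereal_sup [set f C | C in [set C | l <= side C]].

Lemma limsup_cubesE f : limsup_cubes f = ereal_inf (range (tail_sup f)).
Proof.
apply/cvg_lim => //; apply: nonincreasing_cvge => l l' ll'.
apply: ereal_sup_le => _ [C /= C_l' <-].
by exists C => //=; exact: le_trans C_l'.
Qed.

Lemma limsup_cubes_lt f x : (limsup_cubes f < x)%E ->
  exists l : R, forall C, l <= side C -> (f C < x)%E.
Proof.
rewrite limsup_cubesE => /ereal_inf_lt[_ [l _ <-]] lx; exists l => C lC.
by apply: le_lt_trans lx; apply: ereal_sup_ubound; exists C.
Qed.

Lemma le_limsup_cubes f g (l0 : R) :
  (forall C, l0 <= side C -> (f C <= g C)%E) ->
  (limsup_cubes f <= limsup_cubes g)%E.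
Proof.
move=> fg; rewrite !limsup_cubesE; apply: le_ereal_inf_tmp => _ [l _ <-].
apply: le_trans (ereal_inf_lbound _) _.
  by exists (Num.max l0 l).
apply: ge_ereal_sup => _ [C /= + <-]; rewrite ge_max => /andP[l0C lC].
by apply: le_trans (fg _ l0C) _; apply: ereal_sup_ubound; exists C.
Qed.

Lemma limsup_cubes_eq0 f : (forall C, 0 <= f C)%E ->
  (forall e : R, 0 < e ->
    exists l : R, forall C, l <= side C -> (f C <= e%:E)%E) ->
  limsup_cubes f = 0%E.
Proof.
move=> f0 fe; apply/eqP; rewrite eq_le limsup_cubesE; apply/andP; split.
  apply/lee_addgt0Pr => e e0; rewrite add0e; have [l lC] := fe e e0.
  apply: le_trans (ereal_inf_lbound _) _; first by exists l.
  by apply: ge_ereal_sup => _ [C /= /lC ? <-].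
apply: le_ereal_inf_tmp => _ [l _ <-].
have m0 : 0 < Num.max l 1 by rewrite lt_max ltr01 orbT.
apply: le_trans (f0 (0, PosNum m0)) _; apply: ereal_sup_ubound.
by exists (0, PosNum m0) => //=; rewrite /side /= le_max lexx.
Qed.

End limsup_cubes.

(** * Covering content and covering measure *)

Section covering_content.
Context {R : realType} {d : nat} (alpha : R) (A : set 'rV[R]_d).
Implicit Types (C : cube R d) (S : set (cube R d)) (r : R).

Lemma esum_cover_ge0 C S :
  (0 <= \esum_(Ci in S) ((side Ci / side C) `^ alpha)%:E)%E.
Proof. by apply: esum_ge0 => Ci _; rewrite lee_fin powR_ge0. Qed.

Lemma covering_content_ge0 r C : (0 <= covering_content alpha A r C)%E.
Proof.
rewrite /covering_content /inf0; case: ifP => // _.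
by apply: le_ereal_inf_tmp => _ [S _ <-]; exact: esum_cover_ge0.
Qed.

Lemma covering_content_le r C S : admissible_cover A r C S ->
  (covering_content alpha A r C <=
   \esum_(Ci in S) ((side Ci / side C) `^ alpha)%:E)%E.
Proof.
move=> adm; rewrite /covering_content /inf0; case: ifP => _.
  exact: esum_cover_ge0.
by apply: ereal_inf_lbound; exists S.
Qed.

(** Provides a cover, so that the convention for the infimum of the empty set
    only matters for small cubes. *)
Lemma unit_cover_admissible r C : 1 <= r * side C ->
  admissible_cover A r C [set Ci : cube R d | side Ci = 1].
Proof.
move=> rC; split=> [a _|Ci /= ->]; last by rewrite lexx.
exists (a, 1%:pos) => //= i; rewrite lexx/= ltrDl.
exact: side_gt0.
Qed.

Lemma covering_contentE r C : 1 <= r * side C ->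
  covering_content alpha A r C =
  ereal_inf [set (\esum_(Ci in S) ((side Ci / side C) `^ alpha)%:E)%E |
    S in admissible_cover A r C].
Proof.
move=> rC; rewrite /covering_content /inf0 asboolF//.
apply/eqP/set0P; eexists; eexists; last reflexivity.
exact: unit_cover_admissible.
Qed.

Lemma le_covering_content r r' C : r <= r' -> 1 <= r * side C ->
  (covering_content alpha A r' C <= covering_content alpha A r C)%E.
Proof.
move=> rr' rC; rewrite (covering_contentE rC).
apply: le_ereal_inf_tmp => _ [S [AS sS] <-]; apply: covering_content_le.
split=> // Ci /sS /andP[-> Cir]/=; apply: le_trans Cir _.
by rewrite ler_wpM2r// ltW// side_gt0.
Qed.

(** For cubes of side at least 1/r, shrinking r only removes covers; the upper
    limit over large cubes is thus monotone in r. *)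
Lemma is_cvg_covering_measure :
  cvg ((fun r : R => limsup_cubes (covering_content alpha A r)) @ 0^'+).
Proof.
apply: nonincreasing_at_right_is_cvge; near=> x => r r'.
rewrite !in_itv/= => /andP[r0 _] _ rr'.
apply: (@le_limsup_cubes _ _ _ _ r^-1) => C rC; apply: le_covering_content => //.
by rewrite -(mulfV (lt0r_neq0 r0)) ler_pM2l.
Unshelve. all: by end_near. Qed.

(** The limit being 0, the upper limit is below 1 for some r <= 1/2, and an
    infimum below 1 gives the cover. The lower bound r^-1 on the side ensures
    that a genuine infimum is taken. *)
Lemma covering_measure0_covers : covering_measure alpha A = 0%E ->
  exists l : R, forall C, l <= side C -> exists2 S,
    admissible_cover A 2^-1 C S &
    (\esum_(Ci in S) ((side Ci / side C) `^ alpha)%:E <= 1)%E.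
Proof.
move=> m0.
have [r [r0 r2 lim_r]] : exists r : R, [/\ 0 < r, r <= 2^-1 &
    (limsup_cubes (covering_content alpha A r) < 1)%E].
  have : (limsup_cubes (covering_content alpha A r) @[r --> 0^'+]) --> 0%E.
    by rewrite -m0; exact: is_cvg_covering_measure.
  have /[swap]/[apply] := @open_ereal_lt' R 0%E 1%E lte01.
  move=> /= lt1; near (0 : R)^'+ => r; exists r; split.
  - by near: r; exact: nbhs_right_gt.
  - by near: r; apply: nbhs_right_le; rewrite invr_gt0.
  - by near: r.
have [l lC] := limsup_cubes_lt lim_r.
exists (Num.max l r^-1) => C; rewrite ge_max => /andP[/lC + rC].
rewrite covering_contentE; last by rewrite -(mulfV (lt0r_neq0 r0)) ler_pM2l.
move=> /ereal_inf_lt[_ [S [AS sS] <-]] /ltW S1; exists S => //; split=> // Ci.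
move=> /sS /andP[-> Cir]/=; apply: le_trans Cir _.
by rewrite ler_wpM2r// ltW// side_gt0.
Unshelve. all: by end_near. Qed.

End covering_content.

(** * Floor points in a cube *)

Section floor_sets.
Context {R : realType} {d : nat} (A : set 'rV[R]_d).
Implicit Types (C : cube R d) (S : set (cube R d)).

(** Flooring moves each coordinate down by less than 1. One extra unit of side
    absorbs this: at the upper end ([shift = 0]) to recover the points from
    their floors, at the lower end ([shift = 1]) to catch the floors of the
    points of C. *)
Definition grow (shift : R) C : cube R d :=
  (C.1 - const_mx shift, (C.2%:num + 1)%:pos).

Definition unit_cube (z : 'rV[int]_d) : cube R d := (map_mx intr z, 1%:pos).

Lemma floor_set_sub_bigcup (X : set 'rV[R]_d) S :
  X `<=` \bigcup_(Ci in S) cube_set Ci ->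
  floor_set X `<=` \bigcup_(Ci in S) floor_set (X `&` cube_set Ci).
Proof.
move=> XS _ [a Xa <-]; have [Ci SCi Cia] := XS a Xa.
by exists Ci => //; exists a.
Qed.

(** The bound is uniform in the position of C: relative to the floor of the
    lower corner, the floor points have coordinates between 0 and L + 1, so
    there are at most as many as functions from 'I_d to 'I_n.+1, n > L + 1. *)
Lemma counting_floor_box (L : R) : 0 <= L ->
  exists2 K : R, 0 <= K & forall C, side C <= L ->
    (counting (floor_set (A `&` cube_set C)) <= K%:E)%E.
Proof.
move=> L0; pose n := Num.bound (L + 1).
have Ln : L + 1 < n%:R by apply: archi_boundP; rewrite addr_ge0.
pose T := {ffun 'I_d -> 'I_n.+1}.
pose K := counting [set: T] : \bar R.
have Kfin : K = (fine K)%:E.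
  by rewrite /K /counting asboolT//; exact: finite_finset.
exists (fine K); first by rewrite fine_ge0// counting_ge0.
move=> C CL; rewrite -Kfin; apply: le_counting.
pose F (g : T) : 'rV[int]_d := \row_i (Num.floor (C.1 0 i) + (g i)%:Z).
apply: card_le_trans (card_image_le F setT).
apply: subset_card_le => _ [a [_ aC] <-].
pose g (i : 'I_d) : 'I_n.+1 :=
  inord (absz (Num.floor (a 0 i) - Num.floor (C.1 0 i))%R).
exists [ffun i => g i] => //.
apply/rowP => i; rewrite !mxE ffunE /g.
have /andP[Ca aCL] := aC i.
have fle : Num.floor (C.1 0 i) <= Num.floor (a 0 i) by exact: le_floor.
rewrite inordK.
  by rewrite gez0_abs ?subr_ge0// addrC subrK.
rewrite ltnS -lez_nat gez0_abs ?subr_ge0// -(ler_int R) rmorphB/=.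
have := floor_le (a 0 i); have := floorD1_gt (C.1 0 i); rewrite intrD.
rewrite -[n%:~R]/(n%:R); lra.
Qed.

Lemma floor_set_int_points_sub C :
  floor_set A `&` int_points C `<=` floor_set (A `&` cube_set (grow 0 C)).
Proof.
move=> _ [[a Aa <-] aC]; exists a => //; split=> // i.
have := aC i; have := floor_itv (a 0 i); rewrite /side /= !mxE intrD subr0; lra.
Qed.

Lemma floor_set_cube_sub C :
  floor_set (A `&` cube_set C) `<=` floor_set A `&` int_points (grow 1 C).
Proof.
move=> _ [a [Aa aC] <-]; split; first by exists a.
move=> i; have := aC i; have := floor_itv (a 0 i).
rewrite /side /= !mxE intrD; lra.
Qed.

End floor_sets.

(** * From good covers to polynomial growth *)

Section growth.
Context {R : realType} {d : nat} (alpha : R) (A : set 'rV[R]_d).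
Implicit Types (C : cube R d) (S : set (cube R d)).

Lemma powR_ge1 (x : R) : 0 <= alpha -> 1 <= x -> 1 <= x `^ alpha.
Proof. by move=> alpha0 x1; rewrite -(powRr0 x) ler_powR. Qed.

(** Induction on the number n of halvings that bring the side of C below L.
    Covers of content at most 1 let the same constant K serve at every scale;
    K is the bound for the cubes of side at most L, where the factor
    [side C `^ alpha >= 1] is slack. *)
Lemma covers_growth (l : R) : 0 <= alpha ->
  (forall C, l <= side C -> exists2 S, admissible_cover A 2^-1 C S &
    (\esum_(Ci in S) ((side Ci / side C) `^ alpha)%:E <= 1)%E) ->
  exists2 K : R, 0 <= K & forall C, 1 <= side C ->
    (counting (floor_set (A `&` cube_set C)) <= (K * side C `^ alpha)%:E)%E.
Proof.
move=> alpha0 cov; pose L := Num.max l 1.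
have L0 : 0 < L by rewrite lt_max ltr01 orbT.
have [K K0 boxK] := counting_floor_box A (ltW L0).
exists K => // C C1.
have [n] : exists n : nat, side C <= L *+ 2 ^ n.
  exists (Num.bound (side C)).
  apply: le_trans (ltW (archi_boundP (ltW (side_gt0 C)))) _.
  rewrite -[leRHS]mulr_natr -[leLHS]mul1r ler_pM//.
    by rewrite le_max lexx orbT.
  by rewrite ler_nat ltnW// ltn_expl.
elim: n C C1 => [|n IHn] C C1 Cn.
  apply: le_trans (boxK _ Cn) _.
  by rewrite lee_fin ler_peMr// powR_ge1.
have [CL|LC] := leP (side C) L.
  apply: le_trans (boxK _ CL) _.
  by rewrite lee_fin ler_peMr// powR_ge1.
have [|S [AS sS] S1] := cov C.
  by apply: le_trans (ltW LC); rewrite le_max lexx.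
apply: le_trans (le_counting R (subset_card_le (floor_set_sub_bigcup AS))) _.
apply: le_trans (counting_bigcup_le _ _ _) _.
have KC0 : (0 <= (K * side C `^ alpha)%:E)%E.
  by rewrite lee_fin mulr_ge0// powR_ge0.
apply: (@le_trans _ _ (\esum_(Ci in S)
   ((K * side C `^ alpha)%:E * ((side Ci / side C) `^ alpha)%:E))%E).
  apply: le_esum => Ci SCi; have /andP[Ci1 CiC] := sS _ SCi.
  rewrite -EFinM -mulrA -powRM ?divr_ge0 ?(ltW (side_gt0 _))//.
  rewrite mulrCA divff ?mulr1 ?gt_eqF ?side_gt0//.
  apply: le_trans (IHn Ci Ci1 _).
    by apply/le_counting/subset_card_le => _ [a [[Aa _] aCi] <-]; exists a.
  apply: le_trans CiC _.
  by rewrite ler_pdivrMl// mulr_natl -mulrnA mulnC -expnS.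
apply: le_trans (esumZl_le _ _ _) _ => //.
  by move=> Ci; rewrite lee_fin powR_ge0.
by rewrite -[leRHS]mule1; apply: lee_wpmul2l.
Qed.

End growth.

(** * Comparing the two measures and the two dimensions *)

Section dimensions.
Context {R : realType} {d : nat} (A : set 'rV[R]_d).
Implicit Types (C : cube R d).

(** The count divided by [side C `^ beta] is of order
    [side C `^ (alpha - beta)] at most, which tends to 0. *)
Lemma growth_counting_measure0 (alpha beta K : R) :
  0 <= alpha -> alpha < beta -> 0 <= K ->
  (forall C, 1 <= side C ->
    (counting (floor_set (A `&` cube_set C)) <= (K * side C `^ alpha)%:E)%E) ->
  counting_measure beta A = 0%E.
Proof.
move=> alpha0 ab K0 growthA; apply: limsup_cubes_eq0 => [C|e e0].
  by rewrite mule_ge0 ?counting_ge0// lee_fin invr_ge0 powR_ge0.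
have ba0 : 0 < beta - alpha by rewrite subr_gt0.
(* Passing from C to [grow 0 C] at most doubles the side, whence the factor
   [2 `^ alpha]. *)
pose M := K * 2 `^ alpha.
have M0 : 0 <= M by rewrite mulr_ge0 ?powR_ge0.
exists (Num.max 1 ((M / e) `^ (beta - alpha)^-1)) => C.
rewrite ge_max => /andP[C1 Ce].
have C0 := side_gt0 C.
apply: (@le_trans _ _ ((M * side C `^ alpha)%:E * ((side C `^ beta)^-1)%:E)%E).
  rewrite lee_wpmul2r ?lee_fin ?invr_ge0 ?powR_ge0//.
  have sub := @floor_set_int_points_sub _ _ A C.
  apply: le_trans (le_counting R (subset_card_le sub)) _.
  apply: le_trans (growthA _ _) _; first by rewrite /side /= lerDr.
  rewrite lee_fin -mulrA ler_wpM2l// -powRM ?(ltW C0)//.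
  rewrite ge0_ler_powR ?nnegrE ?mulr_ge0 ?(ltW (side_gt0 _))//.
  by rewrite /side /= mulr_natl mulr2n lerD2l.
rewrite -EFinM lee_fin -mulrA -powRN -powRD; last by rewrite (gt_eqF C0) implybT.
rewrite -opprB powRN ler_pdivrMr ?powR_gt0// mulrC -ler_pdivrMr//.
have Me0 : 0 <= M / e by rewrite divr_ge0// ltW.
have -> : M / e = ((M / e) `^ (beta - alpha)^-1) `^ (beta - alpha).
  by rewrite -powRrM mulVf ?gt_eqF// powRr1.
by rewrite ge0_ler_powR ?nnegrE ?powR_ge0 ?(ltW ba0) ?(ltW C0).
Qed.

(** The unit cubes at the floor points of A in [grow 1 C] cover A in C, and
    their content is the number of these points over [side C `^ alpha]; the
    side of [grow 1 C] is at most twice that of C. *)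
Lemma counting_measure0_covering (alpha : R) : 0 <= alpha ->
  counting_measure alpha A = 0%E -> covering_measure alpha A = 0%E.
Proof.
move=> alpha0 m0.
suff r0 (r : R) : 0 < r -> limsup_cubes (covering_content alpha A r) = 0%E.
  apply/cvg_lim => //; apply: (@cvg_trans _ ((fun=> 0%E) @ (0 : R)^'+)).
    2: exact: cvg_cst.
  by apply: near_eq_cvg; near=> r; rewrite r0.
move=> r0; apply: limsup_cubes_eq0 => [C|e e0].
  exact: covering_content_ge0.
have p0 : 0 < 2 `^ alpha :> R by rewrite powR_gt0.
have m_lt : (counting_measure alpha A < (e / 2 `^ alpha)%:E)%E.
  by rewrite m0 lte_fin divr_gt0.
have [l lC] := limsup_cubes_lt m_lt.
exists (Num.max l (Num.max 1 r^-1)) => C; rewrite !ge_max => /and3P[Cl C1 Cr].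
have C0 := side_gt0 C; pose C' := grow 1 C.
have CC' : side C <= side C' by rewrite /side /= lerDl.
have {lC} := lC C' (le_trans Cl CC'); set T := _ `&` _ => T_lt.
have adm : admissible_cover A r C (unit_cube @` T).
  split=> [a Aa|_ [z _ <-]]; last first.
    by rewrite /side /= lexx/= -(mulfV (lt0r_neq0 r0)) ler_pM2l.
  exists (unit_cube (map_mx Num.floor a)).
    by exists (map_mx Num.floor a) => //; apply: floor_set_cube_sub; exists a.
  by move=> i; have := floor_itv (a 0 i); rewrite /side /= !mxE intrD.
apply: le_trans (covering_content_le alpha adm) _.
rewrite esum_image; last first.
  move=> z z' _ _ [] /matrixP zz'; apply/matrixP => i j.
  by have := zz' i j; rewrite !mxE => /intr_inj.
pose c := (1 / side C) `^ alpha.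
apply: (@le_trans _ _ (\esum_(z in T) (c%:E * (1 : R)%:E))%E).
  by apply: le_esum => z _; rewrite mule1.
apply: le_trans (esumZl_le _ _ _) _; rewrite ?lee_fin ?powR_ge0//.
rewrite esum1_counting muleC.
apply: (@le_trans _ _
  (counting T * ((side C' `^ alpha)^-1)%:E * (2 `^ alpha)%:E)%E).
  rewrite -muleA -EFinM lee_wpmul2l ?counting_ge0// lee_fin.
  rewrite /c div1r -powR_inv1 ?(ltW C0)// -powRrM mulN1r powRN.
  rewrite mulrC ler_pdivlMr ?powR_gt0 ?side_gt0// mulrC ler_pdivrMr ?powR_gt0//.
  rewrite -powRM ?(ltW C0)// ge0_ler_powR ?nnegrE ?mulr_ge0 ?(ltW (side_gt0 _))//.
  by rewrite /C' /side /= mulr_natl mulr2n lerD2l.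
apply: (@le_trans _ _ ((e / 2 `^ alpha)%:E * (2 `^ alpha)%:E)%E).
  by rewrite lee_wpmul2r ?lee_fin ?powR_ge0// ltW.
by rewrite -EFinM divfK ?gt_eqF.
Unshelve. all: by end_near. Qed.

End dimensions.

Theorem theoremA (R : realType) (d : nat) (d_ge1 : (1 <= d)%N)
    (A : set 'rV[R]_d) :
  covering_dim A = counting_dim A.
Proof.
apply/eqP; rewrite eq_le; apply/andP; split.
  apply: ereal_inf_le_tmp => _ [alpha [alpha0 m0] <-].
  by exists alpha => //; split=> //; exact: counting_measure0_covering.
apply: le_ereal_inf_tmp => _ [alpha [alpha0 m0] <-].
have [l covers] := covering_measure0_covers m0.
have [K K0 growthA] := covers_growth alpha0 covers.
apply/lee_addgt0Pr => e e0; apply: ereal_inf_lbound.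
exists (alpha + e) => //; split; first by rewrite addr_ge0// ltW.
by apply: (growth_counting_measure0 alpha0 _ K0 growthA); rewrite ltrDl.
Qed.
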